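(* Let $p$ be a prime and $d\ge 1$. Let $\phi:\mathbb{F}_p((t))\to \mathrm{Aut}(\mathbb{F}_p((t))^d)$ be a continuous group homomorphism satisfying $$\phi(tf)=\tau\circ\phi(f)\circ\tau^{-1}\quad\text{for all } f\in\mathbb{F}_p((t)),$$ where $\tau:\mathbb{F}_p((t))^d\to\mathbb{F}_p((t))^d$, $(f_1,\dots,f_d)\mapsto(tf_1,\dots,tf_d)$. Then there is $\xi\in\mathbb{F}_p((t))^d\setminus\{0\}$ such that $\phi(f)(\xi)=\xi$ for every $f\in\mathbb{F}_p((t))$.
   Context: $\mathbb{F}_p((t))$ denotes the additive group of formal Laurent series over $\mathbb{F}_p$, with its usual locally compact totally disconnected topology, in which $\mathbb{F}_p[[t]]$ is a compact open subgroup; $\mathbb{F}_p((t))^d$ carries the product topology. $\mathrm{Aut}(\mathbb{F}_p((t))^d)$ is the group of automorphisms of the topological group $(\mathbb{F}_p((t))^d,+)$ (not necessarily $\mathbb{F}_p((t))$-linear), equipped with the Braconnier topology: the group topology having as a basis of identity neighbourhoods the sets $\{\alpha : \alpha(x)-x\in U \text{ and } \alpha^{-1}(x)-x\in U \text{ for all } x\in K\}$ with $K$ compact and $U$ an identity neighbourhood. *)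

(* Defs.v *)
From mathcomp Require Import all_boot all_algebra.
From Stdlib Require Import ZArith Lia List.
Set Implicit Arguments. Unset Strict Implicit. Unset Printing Implicit Defensive.
Import GRing.Theory.
Local Open Scope ring_scope.

Section LaurentSeries.
Variable p : nat.

Record LS := MkLS {
  coef : Z -> 'F_p ;
  coef_lb : exists N : Z, forall n : Z, (n < N)%Z -> coef n = 0
}.

Lemma ls_zero_lb : exists N : Z, forall n : Z, (n < N)%Z -> (fun _ : Z => (0 : 'F_p)) n = 0.
Proof. by exists 0%Z. Qed.
Definition ls_zero : LS := MkLS ls_zero_lb.

Lemma ls_add_lb (f g : LS) :
  exists N : Z, forall n : Z, (n < N)%Z -> (fun k => coef f k + coef g k) n = 0.
Proof.
case: (coef_lb f) => N1 H1; case: (coef_lb g) => N2 H2.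
exists (Z.min N1 N2) => n Hn /=.
rewrite H1 ?H2 ?addr0 //; lia.
Qed.
Definition ls_add (f g : LS) : LS := MkLS (ls_add_lb f g).

Lemma ls_opp_lb (f : LS) :
  exists N : Z, forall n : Z, (n < N)%Z -> (fun k => - coef f k) n = 0.
Proof.
case: (coef_lb f) => N H; exists N => n Hn /=; by rewrite H ?oppr0.
Qed.
Definition ls_opp (f : LS) : LS := MkLS (ls_opp_lb f).
Definition ls_sub (f g : LS) : LS := ls_add f (ls_opp g).

Lemma ls_t_lb (f : LS) :
  exists N : Z, forall n : Z, (n < N)%Z -> (fun k => coef f (k - 1)%Z) n = 0.
Proof.
case: (coef_lb f) => N H; exists (N + 1)%Z => n Hn /=; apply: H; lia.
Qed.
Definition ls_t (f : LS) : LS := MkLS (ls_t_lb f).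

Lemma ls_tinv_lb (f : LS) :
  exists N : Z, forall n : Z, (n < N)%Z -> (fun k => coef f (k + 1)%Z) n = 0.
Proof.
case: (coef_lb f) => N H; exists (N - 1)%Z => n Hn /=; apply: H; lia.
Qed.
Definition ls_tinv (f : LS) : LS := MkLS (ls_tinv_lb f).

(* V n = t^n F_p[[t]] : the basic compact open subgroups (identity nbhds). *)
Definition Vn (n : Z) (f : LS) : Prop := forall k : Z, (k < n)%Z -> coef f k = 0.

Definition openLS (W : LS -> Prop) : Prop :=
  forall f, W f -> exists n : Z, forall g, Vn n (ls_sub g f) -> W g.

Section Vectors.
Variable d : nat.

Definition X := 'I_d -> LS.
Definition X0 : X := fun _ => ls_zero.
Definition Xadd (x y : X) : X := fun i => ls_add (x i) (y i).
Definition Xsub (x y : X) : X := fun i => ls_sub (x i) (y i).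

Definition openX (W : X -> Prop) : Prop :=
  forall x, W x -> exists n : Z, forall y, (forall i, Vn n (ls_sub (y i) (x i))) -> W y.

Definition nbhd0X (U : X -> Prop) : Prop :=
  exists W, openX W /\ W X0 /\ forall x, W x -> U x.

Definition compactX (K : X -> Prop) : Prop :=
  forall (I : Type) (O : I -> X -> Prop),
    (forall i, openX (O i)) -> (forall x, K x -> exists i, O i x) ->
    exists s : list I, forall x, K x -> exists i, In i s /\ O i x.

Definition continuousX (a : X -> X) : Prop :=
  forall W, openX W -> openX (fun x => W (a x)).

Record Aut := MkAut {
  aut_fun : X -> X ;
  aut_inv : X -> X ;
  aut_additive : forall x y, aut_fun (Xadd x y) = Xadd (aut_fun x) (aut_fun y) ;
  aut_invK : forall x, aut_inv (aut_fun x) = x ;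
  aut_funK : forall x, aut_fun (aut_inv x) = x ;
  aut_fun_cont : continuousX aut_fun ;
  aut_inv_cont : continuousX aut_inv
}.

(* beta lies in the basic neighbourhood alpha o N(K,U) of alpha, where
   N(K,U) = {g | g x - x in U and g^-1 x - x in U for all x in K};
   here g = alpha^-1 o beta and g^-1 = beta^-1 o alpha. *)
Definition in_braconnier_nbhd (K U : X -> Prop) (alpha beta : Aut) : Prop :=
  forall x, K x ->
    U (Xsub (aut_inv alpha (aut_fun beta x)) x) /\
    U (Xsub (aut_inv beta (aut_fun alpha x)) x).

Definition openAut (W : Aut -> Prop) : Prop :=
  forall alpha, W alpha -> exists K U, compactX K /\ nbhd0X U /\
    forall beta, in_braconnier_nbhd K U alpha beta -> W beta.

Definition tau (x : X) : X := fun i => ls_t (x i).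
Definition tau_inv (x : X) : X := fun i => ls_tinv (x i).

End Vectors.
End LaurentSeries.

(* Main.v *)
(* Write [G = F_p((t))] and [X_k = t^k F_p[[t]]^d].  By compactness there is a
   vector [y] outside [X_1] whose whole orbit stays in [X_0], so
   [Z = {x | G x <= X_0}] is a nonzero compact [G]-invariant subgroup with
   [tau Z <= Z], and [Z / tau^k Z] is finite.  If no vector of [Z \ tau Z] were
   fixed modulo [tau^k Z], the [i]-th socle of the [G]-module
   [W / Z], [W] the union of the [tau^-j Z], would lie in [tau^(-ik) Z / Z].
   Hence [G] acts on the second socle through a finite quotient; since [G] is
   commutative of exponent [p], this bounds the socle length of [W / Z], so
   [W / Z] is finite, contradicting [Z <> 0].  Vectors of [Z \ tau Z] fixed
   modulo [tau^k Z] for each [k] accumulate at a fixed vector. *)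
Require Import Defs.
From Stdlib Require Import ZArith List Lia.
From HB Require Import structures.
From mathcomp Require Import all_boot all_algebra.
From mathcomp Require Import zify boolp.

(* [all_algebra] rebinds the key [%Z] to the integers of MathComp. *)
Delimit Scope Z_scope with Z.

Set Implicit Arguments. Unset Strict Implicit. Unset Printing Implicit Defensive.

(** * Finite bounds and stabilisation of bounded sequences *)

Lemma Z_fin_ub (T : finType) (N : T -> Z) : exists k, forall i, (N i <= k)%Z.
Proof.
have [k Hk] : exists k : Z, forall i, i \in enum T -> (N i <= k)%Z.
  elim: (enum T) => [|j s [k Hk]]; first by exists 0%Z.
  exists (Z.max k (N j)) => i; rewrite inE => /orP[/eqP->|/Hk]; lia.
by exists k => i; apply: Hk; rewrite mem_enum.
Qed.

Lemma nondecreasing_bounded_stable (u : nat -> nat) B :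
  (forall n, u n <= u n.+1)%N -> (forall n, u n <= B)%N ->
  exists n0, forall n, (n0 <= n)%N -> u n = u n0.
Proof.
move=> um uB.
have ex : exists v, `[< exists n, u n = v >] by exists (u 0%N); apply/asboolP; exists 0%N.
have ub v : `[< exists n, u n = v >] -> (v <= B)%N by move=> /asboolP[n <-].
case: (ex_maxnP ex ub) => v /asboolP[n0 <-] vmax; exists n0 => n n0n.
apply/eqP; rewrite eqn_leq vmax; last by apply/asboolP; exists n.
rewrite -(subnK n0n); elim: (n - n0)%N => //= m IHm.
exact: leq_trans IHm (um _).
Qed.

(** * The groups F_p((t)) and F_p((t))^d, multiplication by t^k, and balls *)

Section LaurentVectors.
Import GRing.Theory.
Local Open Scope ring_scope.

Variable p : nat.

Lemma ls_eq (f g : LS p) : coef f =1 coef g -> f = g.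
Proof.
case: f g => [f Hf] [g Hg] /= /funext E; subst g.
by congr MkLS; apply: Prop_irrelevance.
Qed.

HB.instance Definition _ := gen_eqMixin (LS p).
HB.instance Definition _ := gen_choiceMixin (LS p).

Lemma ls_addA : associative (@ls_add p).
Proof. by move=> f g h; apply: ls_eq => n /=; rewrite addrA. Qed.
Lemma ls_addC : commutative (@ls_add p).
Proof. by move=> f g; apply: ls_eq => n /=; rewrite addrC. Qed.
Lemma ls_add0 : left_id (ls_zero p) (@ls_add p).
Proof. by move=> f; apply: ls_eq => n /=; rewrite add0r. Qed.
Lemma ls_addN : left_inverse (ls_zero p) (@ls_opp p) (@ls_add p).
Proof. by move=> f; apply: ls_eq => n /=; rewrite addNr. Qed.
HB.instance Definition _ :=
  GRing.isZmodule.Build (LS p) ls_addA ls_addC ls_add0 ls_addN.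

Variable d : nat.

Lemma X_eq (x y : X p d) : (forall i n, coef (x i) n = coef (y i) n) -> x = y.
Proof. by move=> E; apply/funext => i; apply: ls_eq => n. Qed.

HB.instance Definition _ := gen_eqMixin (X p d).
HB.instance Definition _ := gen_choiceMixin (X p d).

Definition Xopp (x : X p d) : X p d := fun i => ls_opp (x i).
Lemma Xadd_A : associative (@Xadd p d).
Proof. by move=> x y z; apply: X_eq => i n /=; rewrite addrA. Qed.
Lemma Xadd_C : commutative (@Xadd p d).
Proof. by move=> x y; apply: X_eq => i n /=; rewrite addrC. Qed.
Lemma Xadd_0 : left_id (@X0 p d) (@Xadd p d).
Proof. by move=> x; apply: X_eq => i n /=; rewrite add0r. Qed.
Lemma Xadd_N : left_inverse (@X0 p d) Xopp (@Xadd p d).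
Proof. by move=> x; apply: X_eq => i n /=; rewrite addNr. Qed.
HB.instance Definition _ :=
  GRing.isZmodule.Build (X p d) Xadd_A Xadd_C Xadd_0 Xadd_N.

Lemma shift_lb (k : Z) (f : LS p) :
  exists N : Z, forall n : Z, (n < N)%Z -> (fun n => coef f (n - k)%Z) n = 0.
Proof. by case: (coef_lb f) => N H; exists (N + k)%Z => n Hn /=; apply: H; lia. Qed.
Definition shift (k : Z) (f : LS p) : LS p := MkLS (shift_lb k f).
Definition shiftX (k : Z) (x : X p d) : X p d := fun i => shift k (x i).

Lemma shift_shift a b f : shift a (shift b f) = shift (a + b) f.
Proof. by apply: ls_eq => n /=; congr (coef f); lia. Qed.
Lemma shift0 f : shift 0 f = f.
Proof. by apply: ls_eq => n /=; congr (coef f); lia. Qed.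
Lemma shift_t f : ls_t f = shift 1 f.
Proof. exact: ls_eq. Qed.
Lemma shiftX_shiftX a b x : shiftX a (shiftX b x) = shiftX (a + b) x.
Proof. by apply/funext => i; apply: shift_shift. Qed.
Lemma shiftX0 x : shiftX 0 x = x.
Proof. by apply/funext => i; apply: shift0. Qed.
Lemma shiftX_tau x : tau x = shiftX 1 x.
Proof. exact: X_eq. Qed.
Lemma shiftX_tau_inv x : tau_inv x = shiftX (-1) x.
Proof. by apply: X_eq => i n /=; congr (coef _); lia. Qed.
Lemma shiftXB k x y : shiftX k (x - y) = shiftX k x - shiftX k y.
Proof. exact: X_eq. Qed.

Definition ball (k : Z) (x : X p d) : Prop := forall i, Vn k (x i).

Lemma ball_le k l x : (k <= l)%Z -> ball l x -> ball k x.
Proof. by move=> kl Hx i n nk; apply: Hx; lia. Qed.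
Lemma ballD k x y : ball k x -> ball k y -> ball k (x + y).
Proof. by move=> Hx Hy i n nk /=; rewrite Hx // Hy // addr0. Qed.
Lemma ballN k x : ball k x -> ball k (- x).
Proof. by move=> Hx i n nk /=; rewrite Hx // oppr0. Qed.
Lemma ballB k x y : ball k x -> ball k y -> ball k (x - y).
Proof. by move=> Hx Hy; apply: ballD => //; apply: ballN. Qed.
Lemma ball_subr k x y : ball k x -> ball k (y - x) -> ball k y.
Proof. by move=> Hx Hxy; rewrite -(subrK x y); apply: ballD. Qed.
Lemma ball_shift k l x : ball k (shiftX l x) <-> ball (k - l) x.
Proof.
split=> Hx i n nk /=; last by apply: Hx; lia.
by have /= := Hx i (n + l)%Z ltac:(lia); rewrite Z.add_simpl_r.
Qed.
Lemma ball_all_eq0 x : (forall k, ball k x) -> x = 0.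
Proof. by move=> Hx; apply: X_eq => i n /=; apply: (Hx (n + 1)%Z); lia. Qed.
Lemma ball_open k : openX (@ball k).
Proof. by move=> x Hx; exists k => y Hy; apply: ball_subr Hx _. Qed.

Lemma openX_ball (W : X p d -> Prop) x :
  openX W -> W x -> exists n, forall y, ball n (y - x) -> W y.
Proof. by move=> HW /HW. Qed.

(** * Compactness of F_p[[t]]^d *)

Lemma monomial_lb (n : Z) (c : 'F_p) :
  exists N : Z, forall k : Z, (k < N)%Z -> (fun k => if (k =? n)%Z then c else 0) k = 0.
Proof. by exists n => k kn; have /Z.eqb_neq-> : k <> n by lia. Qed.
Definition monomial (n : Z) (c : 'F_p) : LS p := MkLS (monomial_lb n c).
Definition monomialX (n : Z) (c : 'I_d -> 'F_p) : X p d := fun i => monomial n (c i).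

(* König's lemma: [t^n F_p[[t]]^d] is a finite union of balls of the next radius. *)
Lemma ball_compact : compactX (ball 0).
Proof.
move=> I O Oo Oc; apply: contrapT => bad0.
pose bad n x := ~ exists s : list I, forall y, ball n (y - x) -> exists i, In i s /\ O i y.
have step n x : bad n x -> exists x', ball n (x' - x) /\ bad (n + 1)%Z x'.
  move=> badx; apply: contrapT => nx; apply: badx.
  have cov (c : {ffun 'I_d -> 'F_p}) : exists s : list I,
      forall y, ball (n + 1)%Z (y - (x + monomialX n c)) -> exists i, In i s /\ O i y.
    apply: contrapT => Hc; apply: nx; exists (x + monomialX n c); split=> //.
    rewrite addrC addKr => i k kn /=.
    by have /Z.eqb_neq-> : k <> n by lia.
  have [S HS] := choice cov.
  exists (flatten [seq S c | c <- enum {: {ffun 'I_d -> 'F_p}}]) => y yx.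
  pose c : {ffun 'I_d -> 'F_p} := [ffun i => coef ((y - x) i) n].
  have /HS[i [iS Oy]] : ball (n + 1)%Z (y - (x + monomialX n c)).
    rewrite opprD addrA => i k kn /=; rewrite ffunE.
    case: Z.eqb_spec => [->|kn'] /=; first by rewrite subrr.
    by have /= -> := yx i k ltac:(lia); rewrite subr0.
  exists i; split=> //.
  have: c \in enum {: {ffun 'I_d -> 'F_p}} by rewrite mem_enum.
  elim: (enum _) => //= c' s IH; rewrite inE.
  by case/orP=> [/eqP<-|/IH H]; apply/in_app_iff; [left|right].
have /choice[G HG] (u : nat * X p d) : exists x', bad (Z.of_nat u.1) u.2 ->
    ball (Z.of_nat u.1) (x' - u.2) /\ bad (Z.of_nat u.1 + 1)%Z x'.
  have [/step[x' Hx']|nbad] := pselect (bad (Z.of_nat u.1) u.2); first by exists x'.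
  by exists 0.
pose F := fix F n := if n is m.+1 then G (m, F m) else 0.
have badF n : bad (Z.of_nat n) (F n).
  elim: n => [|n IHn].
    by case=> s Hs; apply: bad0; exists s => y Hy; apply: Hs; rewrite subr0.
  by rewrite Nat2Z.inj_succ -Z.add_1_r; case: (HG (n, F n) IHn).
have ballF n : ball (Z.of_nat n) (F n.+1 - F n) by case: (HG (n, F n) (badF n)).
have ballFD n m : ball (Z.of_nat n) (F (m + n)%N - F n).
  elim: m => [|m IHm]; first by rewrite subrr.
  rewrite -(subrKA (F (m + n)%N)); apply: ballD => //.
  by apply: ball_le (ballF (m + n)%N); lia.
(* Diagonal limit: the coefficient at [t^n] no longer changes from stage [n + 1] on. For negative
   [n], [Z.to_nat] returns stage 0, the zero vector. *)
have xlb i : exists N : Z, forall n, (n < N)%Z -> coef (F (Z.to_nat (n + 1)) i) n = 0.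
  exists 0%Z => n n0; have -> : Z.to_nat (n + 1) = 0%N by lia.
  by [].
pose x : X p d := fun i => MkLS (xlb i).
have xF n : ball (Z.of_nat n) (x - F n).
  move=> i k kn /=; apply/eqP; rewrite subr_eq0 eq_sym -subr_eq0; apply/eqP.
  have [k0|k0] := Z_lt_le_dec k 0.
    have -> : Z.to_nat (k + 1) = 0%N by lia.
    by have := ballFD 0%N n i k k0; rewrite addn0.
  have -> : n = ((n - Z.to_nat (k + 1)) + Z.to_nat (k + 1))%N.
    by rewrite subnK //; apply/leP; lia.
  by have /= := ballFD (Z.to_nat (k + 1)) (n - Z.to_nat (k + 1))%N i k ltac:(lia).
have [j Oj] : exists j, O j x by apply: Oc => i k k0; have /= := xF 0%N i k k0; rewrite subr0.
have [n Hn] := openX_ball (Oo j) Oj.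
apply: (badF (Z.to_nat n)); exists [:: j] => y Hy; exists j; split; first by left.
apply: Hn; apply: (@ball_le _ (Z.of_nat (Z.to_nat n))); first by lia.
by rewrite -(subrKA (F (Z.to_nat n))); apply: ballD => //; rewrite -opprB; apply: ballN.
Qed.

(** Cantor's intersection theorem: were the intersection empty, the complements would cover
    [ball 0], and a finite subcover would make some [S N] empty. *)
Lemma nested_inter (S : nat -> X p d -> Prop) :
  (forall n x, S n x -> ball 0 x) -> (forall n, openX (fun x => ~ S n x)) ->
  (forall n x, S n.+1 x -> S n x) -> (forall n, exists x, S n x) ->
  exists x, forall n, S n x.
Proof.
move=> Sb So Sd Sn; apply: contrapT => H.
have Smono m n x : S (m + n)%N x -> S n x by elim: m => //= m IH /Sd.
case: (ball_compact So) => [x _|s Hs].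
  by apply/existsNP => Sx; apply: H; exists x.
have [N HN] : exists N, forall n, In n s -> (n <= N)%N.
  elim: s {Hs} => [|n s [N HN]]; first by exists 0%N.
  exists (maxn n N) => k [<-|/HN kN]; first exact: leq_maxl.
  by rewrite leq_max kN orbT.
have [x Sx] := Sn N; have [n [/HN nN]] := Hs x (Sb _ _ Sx); apply.
by apply: (Smono (N - n)%N); rewrite subnK.
Qed.
Lemma autB (a : Aut p d) x y : aut_fun a (x - y) = aut_fun a x - aut_fun a y.
Proof.
apply/eqP; rewrite eq_sym subr_eq; apply/eqP.
by rewrite -[RHS]aut_additive; congr aut_fun; rewrite -[LHS](subrK y).
Qed.

End LaurentVectors.

(** * The action of F_p((t)) and its equicontinuity *)

Section Action.
Import GRing.Theory.
Local Open Scope ring_scope.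
Variables (p d : nat) (p_prime : prime p) (d_gt0 : (0 < d)%N).
Variable phi : LS p -> Aut p d.
Hypothesis phiD : forall (f g : LS p) (x : X p d),
  aut_fun (phi (ls_add f g)) x = aut_fun (phi f) (aut_fun (phi g) x).
Hypothesis phi_cont :
  forall W : Aut p d -> Prop, openAut W -> openLS (fun f => W (phi f)).
Hypothesis phi_tau : forall (f : LS p) (x : X p d),
  aut_fun (phi (ls_t f)) x = tau (aut_fun (phi f) (tau_inv x)).

Definition act (f : LS p) (x : X p d) : X p d := aut_fun (phi f) x.

Lemma actD f g x : act (f + g) x = act f (act g x).
Proof. exact: phiD. Qed.
Lemma actC f g x : act f (act g x) = act g (act f x).
Proof. by rewrite -!actD addrC. Qed.
Lemma act0 x : act 0 x = x.
Proof.
have := actD 0 0 x; rewrite addr0 /act => /(congr1 (aut_inv (phi 0))).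
by rewrite !aut_invK.
Qed.
Lemma act_sub f x y : act f (x - y) = act f x - act f y.
Proof. exact: autB. Qed.
Lemma act_add f x y : act f (x + y) = act f x + act f y.
Proof. exact: aut_additive. Qed.
Lemma act_0 f : act f 0 = 0.
Proof. by have := act_sub f 0 0; rewrite !subrr. Qed.

Lemma act_shift k f x : act (shift k f) (shiftX k x) = shiftX k (act f x).
Proof.
have act1 g y : act (shift 1 g) (shiftX 1 y) = shiftX 1 (act g y).
  rewrite -shift_t /act phi_tau shiftX_tau shiftX_tau_inv shiftX_shiftX.
  by rewrite shiftX0.
have actn n g y :
    act (shift (Z.of_nat n) g) (shiftX (Z.of_nat n) y) = shiftX (Z.of_nat n) (act g y).
  elim: n g y => [|n IHn] g y; first by rewrite shift0 !shiftX0.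
  have -> : Z.of_nat n.+1 = (1 + Z.of_nat n)%Z by lia.
  by rewrite -shift_shift -!shiftX_shiftX act1 IHn.
have [k0|k0] := Z_le_gt_dec 0 k; first by rewrite -(Z2Nat.id k k0) actn.
(* For negative [k], the positive case is applied to the shifted data and then inverted. *)
have := actn (Z.to_nat (- k)) (shift k f) (shiftX k x).
rewrite Z2Nat.id ?shift_shift ?shiftX_shiftX; last by lia.
rewrite Z.add_opp_diag_l shift0 shiftX0 => ->.
by rewrite shiftX_shiftX Z.add_opp_diag_r shiftX0.
Qed.

Lemma act_ball f k : exists N, forall x, ball N x -> ball k (act f x).
Proof.
have [|N HN] := openX_ball (aut_fun_cont (a := phi f) (@ball_open p d k)) (x := 0).
  by rewrite [aut_fun _ _]act_0.
by exists N => x Nx; apply: HN; rewrite subr0.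
Qed.

(** Continuity of [phi] at 0, tested on the set [W] of automorphisms that are close to the identity
    on the compact set [ball 0]. *)
Lemma small_act k :
  exists m, forall f, Vn m f -> forall x, ball 0 x -> ball k (act f x - x).
Proof.
pose W (b : Aut p d) := forall x, ball 0 x -> ball k (aut_fun b x - x).
have /phi_cont Wo : openAut W.
  (* With U the preimage of X_k under [a], the condition a^-1 b x - x in U becomes b x - a x in
     X_k. *)
  move=> a Wa; exists (ball 0), (fun x => ball k (aut_fun a x)).
  split; [exact: ball_compact|split].
    exists (fun x => ball k (aut_fun a x)); split; first exact/aut_fun_cont/ball_open.
    by split=> //; have := autB a 0 0; rewrite !subrr => /= E; rewrite [aut_fun a _]E.
  move=> b Hb x x0; have [Hx _] := Hb x x0; apply: ball_subr (Wa x x0) _.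
  by rewrite opprB subrKA -{1}(aut_funK a (aut_fun b x)) -autB.
have [|m Hm] := Wo 0.
  by move=> x _; rewrite [aut_fun _ _]act0 subrr.
by exists m => f mf; apply: Hm => n nm /=; rewrite mf // sub0r oppr0.
Qed.

(** For a small subgroup V_m' this is [small_act]. Lowering the index by one adds only the finitely
    many cosets of the monomials c t^n, each acting by a single continuous map. *)
Lemma act_equicont m k :
  exists N, forall f, Vn m f -> forall x, ball N x -> ball k (act f x).
Proof.
have [m' Hm'] := small_act k.
have H j : exists N, forall f, Vn (m' - Z.of_nat j)%Z f ->
    forall x, ball N x -> ball k (act f x).
  elim: j => [|j [N HN]].
    exists (Z.max k 0) => f mf x xN.
    have xk : ball k x by apply: ball_le xN; lia.
    apply: ball_subr xk (Hm' f _ x _); last by apply: ball_le xN; lia.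
    by move=> n nm; apply: mf; lia.
  pose n := (m' - Z.of_nat j.+1)%Z.
  have /choice[M HM] (c : 'F_p) := act_ball (monomial n c) N.
  have [M' HM'] := Z_fin_ub M.
  exists M' => f nf x xM.
  rewrite -(subrK (monomial n (coef f n)) f) actD; apply: HN; last first.
    by apply: HM; apply: ball_le xM.
  move=> l lj /=; case: Z.eqb_spec => [->|ln]; first exact: subrr.
  by rewrite subr0; apply: nf; rewrite -/n; lia.
have [N HN] := H (Z.to_nat (m' - m)).
by exists N => f mf; apply: HN => n nm; apply: mf; lia.
Qed.

(** * Existence of a bounded orbit *)

Lemma act_ball_closed f k : openX (fun x => ~ ball k (act f x)).
Proof.
move=> x Hx; have [N HN] := act_ball f k; exists N => y yx yk; apply: Hx.
by rewrite -(subKr (act f y) (act f x)) -act_sub; apply: ballB => //; apply: HN.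
Qed.

(* Otherwise [U_k = {x | V_m x <= X_k}] satisfies [U_k <= U_(k+1)] from some
   [k0] on, whence [U_k0 = 0], although [U_k0] is open by equicontinuity. *)
Lemma bounded_orbit : exists y, ~ ball 1 y /\ forall f, ball 0 (act f y).
Proof.
have [m Hm] := small_act 0.
have key (k0 : nat) : exists k x, [/\ (Z.of_nat k0 <= k)%Z, ~ ball (k + 1) x &
    forall f, Vn m f -> ball k (act f x)].
  apply: contrapT => nk.
  have next k x : (Z.of_nat k0 <= k)%Z -> (forall f, Vn m f -> ball k (act f x)) ->
      ball (k + 1) x.
    by move=> k0k Hx; apply: contrapT => nx; apply: nk; exists k, x.
  have [N HN] := act_equicont m (Z.of_nat k0).
  pose x := monomialX (d := d) N (fun=> 1 : 'F_p).
  have xN : ball N x.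
    by move=> i n nN /=; have /Z.eqb_neq-> : n <> N by lia.
  have Hx j f : Vn m f -> ball (Z.of_nat k0 + Z.of_nat j) (act f x).
    elim: j f => [|j IHj] f mf; first by rewrite Z.add_0_r; apply: HN.
    have -> : (Z.of_nat k0 + Z.of_nat j.+1 = Z.of_nat k0 + Z.of_nat j + 1)%Z by lia.
    apply: next; first by lia.
    move=> g mg; rewrite -actD; apply: IHj => n nm /=.
    by rewrite mf // mg // addr0.
  have x0 : ball (N + 1) x.
    rewrite -(act0 x); apply: (@ball_le _ _ _ (Z.of_nat k0 + Z.of_nat (Z.to_nat (N + 1)))).
      by lia.
    exact: Hx.
  have /= := x0 (Ordinal d_gt0) N ltac:(lia).
  by rewrite Z.eqb_refl; apply/eqP; rewrite oner_eq0.
(* Conjugation by t^-k turns V_m into V_(m-k), so t^-k x, for [k] and [x] from [key n], lies in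
   [S n]. The V_(m-n) exhaust F_p((t)), so a common point has its whole orbit in X_0. *)
pose S n y := ~ ball 1 y /\
  forall f, Vn (m - Z.of_nat n)%Z f -> ball 0 (act f y).
have [||||y Sy] := @nested_inter p d S.
- by move=> n x [_ /(_ 0)]; rewrite act0; apply.
- move=> n x; rewrite /S => /not_andP[/contrapT x1|/existsNP[f /not_implyP[nf fx]]].
    by exists 1%Z => y yx [y1 _]; apply: y1; apply: ball_subr x1 _.
  have [N HN] := act_ball_closed fx; exists N => y yx [_ Hy].
  by apply: (HN y yx); apply: Hy.
- move=> n x [x1 Hx]; split=> // f nf; apply: Hx => k kn; apply: nf; lia.
- move=> n; have [k [x [nk x1 Hx]]] := key n.
  exists (shiftX (- k) x); split.
    by move/ball_shift; rewrite Z.sub_opp_r Z.add_comm.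
  move=> f nf; have := act_shift (- k) (shift k f) x.
  rewrite shift_shift Z.add_opp_diag_l shift0 => ->.
  apply/ball_shift; rewrite Z.sub_opp_r; apply: Hx => l lm /=; apply: nf; lia.
exists y; split; first by case: (Sy 0%N).
move=> f; case: (coef_lb f) => N HN.
by case: (Sy (Z.to_nat (m - N))) => _; apply=> k kN; apply: HN; lia.
Qed.

(** * The invariant lattice Z and its openness properties *)

(* [oball k] is [tau^k Z] for the lattice [Z = {x | G x <= F_p[[t]]^d}]. *)
Definition oball (k : Z) (x : X p d) : Prop := forall f, ball k (act f x).

Lemma oball_ball k x : oball k x -> ball k x.
Proof. by move=> /(_ 0); rewrite act0. Qed.
Lemma oball_le k l x : (k <= l)%Z -> oball l x -> oball k x.
Proof. by move=> kl Hx f; apply: ball_le kl _. Qed.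
Lemma oball0 k : oball k 0.
Proof. by move=> f; rewrite act_0. Qed.
Lemma oballD k x y : oball k x -> oball k y -> oball k (x + y).
Proof. by move=> Hx Hy f; rewrite act_add; apply: ballD. Qed.
Lemma oballB k x y : oball k x -> oball k y -> oball k (x - y).
Proof. by move=> Hx Hy f; rewrite act_sub; apply: ballB. Qed.
Lemma oball_act k f x : oball k x -> oball k (act f x).
Proof. by move=> Hx g; rewrite -actD. Qed.
Lemma oball_shift k l x : oball k (shiftX l x) <-> oball (k - l) x.
Proof.
split=> Hx f.
  by apply/ball_shift; rewrite -act_shift; apply: Hx.
have := act_shift l (shift (- l) f) x; rewrite shift_shift Z.add_opp_diag_r shift0 => ->.
exact/ball_shift/Hx.
Qed.

(* An Artin-Rees argument: the sets of leading coefficients at [t^n] of the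
   [x] in [Z] lying in [X_n] grow with [n], hence stabilise, so a small
   element of [Z] lies in [tau Z] up to arbitrarily small errors. *)
Lemma oball_open : exists n : Z, forall x, oball 0 x -> ball n x -> oball 1 x.
Proof.
pose lead n : {set {ffun 'I_d -> 'F_p}} := [set c : {ffun 'I_d -> 'F_p} |
  `[< exists x, [/\ oball 0 x, ball (Z.of_nat n) x &
        forall i, coef (x i) (Z.of_nat n) = c i] >]].
have leadS n : lead n \subset lead n.+1.
  apply/subsetP => c; rewrite !inE => /asboolP[x [x0 xn xc]].
  apply/asboolP; exists (shiftX 1 x); split.
  - by apply/oball_shift; apply: oball_le x0; lia.
  - by apply/ball_shift; apply: ball_le xn; lia.
  - move=> i; rewrite -xc -[LHS]/(coef (x i) (Z.of_nat n.+1 - 1)).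
    by congr (coef _); lia.
have [|n|n0 Hn0] := @nondecreasing_bounded_stable (fun n => #|lead n|)
    #|{: {ffun 'I_d -> 'F_p}}|.
- by move=> n; apply: subset_leq_card.
- exact: max_card.
have leadE n : (n0 <= n)%N -> lead n = lead n.+1.
  move=> n0n; apply/eqP; rewrite eqEcard leadS /=.
  by rewrite (Hn0 n) // (Hn0 n.+1) // ltnW.
exists (Z.of_nat n0 + 1)%Z => x x0 xn.
have approx j : exists z, [/\ oball 1 z, oball 0 (x - z) &
    ball (Z.of_nat (n0 + j).+1) (x - z)].
  elim: j => [|j [z [z1 xz0 xzn]]].
    exists 0; rewrite subr0; split=> //; first exact: oball0.
    by rewrite addn0; apply: ball_le xn; lia.
  (* Stability gives [y] in Z with the same leading coefficients one degree lower, so t y lies in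
     tau Z and cancels the leading term of the error. *)
  pose c := [ffun i => coef ((x - z) i) (Z.of_nat (n0 + j).+1)].
  have : c \in lead (n0 + j).+1.
    rewrite inE; apply/asboolP; exists (x - z); split=> // i; by rewrite ffunE.
  rewrite -leadE ?leq_addr // inE => /asboolP[y [y0 yn yc]].
  have y1 : oball 1 (shiftX 1 y) by apply/oball_shift.
  exists (z + shiftX 1 y); split; first exact: oballD.
    by rewrite opprD addrA; apply: oballB => //; apply: oball_le y1.
  rewrite opprD addrA => i l Hl.
  have [ln|ln] := Z_lt_le_dec l (Z.of_nat (n0 + j).+1).
    have := xzn i l ln => /= ->; rewrite (yn i) ?subr0 //; lia.
  have -> : l = Z.of_nat (n0 + j).+1 by lia.
  have := yc i; rewrite ffunE => yci.
  rewrite -[LHS]/(coef ((x - z) i) (Z.of_nat (n0 + j).+1) -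
    coef (y i) (Z.of_nat (n0 + j).+1 - 1)) -yci.
  by apply/eqP; rewrite subr_eq0; apply/eqP; congr (coef _ _); lia.
(* The approximation may depend on [f]: the error only has to be small enough for [act f] to send it
   into X_1. *)
move=> f; have [N HN] := act_ball f 1.
have [z [z1 _ xz]] := approx (Z.to_nat N).
rewrite -(subrK z x) act_add; apply: ballD => //; apply: HN.
by apply: ball_le xz; lia.
Qed.

(** The point is that [m] is independent of [j]: [oball_open], rescaled by t^(j+1), moves [x] from
    tau^-(j+1) Z into tau^-j Z, and this is repeated down to Z. *)
Lemma oball_open_neg : exists m : Z, forall j x,
  oball (- Z.of_nat j) x -> ball m x -> oball 0 x.
Proof.
have [n Hn] := oball_open; exists (Z.max n 0); elim=> [|j IHj] x xj xn //.
apply: IHj => //.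
have /Hn : oball 0 (shiftX (Z.of_nat j.+1) x) by apply/oball_shift.
have yn : ball n (shiftX (Z.of_nat j.+1) x).
  by apply/ball_shift; apply: ball_le xn; lia.
by move=> /(_ yn) /oball_shift; apply: oball_le; lia.
Qed.

(** By [oball_open_neg] a vector of tau^-j Z is determined modulo Z by its coefficients from t^-j to
    t^(m-1). Hence tau^-j Z / Z is finite, the group induces finitely many maps on it, and [h]
    chooses a group element for each. *)
Lemma finite_action j : exists (T : finType) (h : T -> LS p), forall g, exists a,
  forall x, oball (- Z.of_nat j) x -> oball 0 (act g x - act (h a) x).
Proof.
have [m Hm] := oball_open_neg.
pose s := Z.to_nat (m + Z.of_nat j).
pose Q := {ffun 'I_d * 'I_s -> 'F_p}.
pose tr (x : X p d) : Q := [ffun u : 'I_d * 'I_s => coef (x u.1) (Z.of_nat u.2 - Z.of_nat j)].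
have trP x y : oball (- Z.of_nat j) x -> oball (- Z.of_nat j) y -> tr x = tr y ->
    oball 0 (x - y).
  move=> xj yj xy; apply: (Hm j); first exact: oballB.
  move=> i n nm /=.
  have [nj|nj] := Z_lt_le_dec n (- Z.of_nat j).
    by rewrite (oball_ball xj) ?(oball_ball yj) ?subr0.
  have us : (Z.to_nat (n + Z.of_nat j) < s)%N by rewrite /s; lia.
  have /ffunP/(_ (i, Ordinal us)) := xy; rewrite !ffunE /=.
  have -> : (Z.of_nat (Z.to_nat (n + Z.of_nat j)) - Z.of_nat j = n)%Z by lia.
  by move=> ->; rewrite subrr.
have /choice[rep repP] (q : Q) : exists x, (exists y, oball (- Z.of_nat j) y /\ tr y = q) ->
    oball (- Z.of_nat j) x /\ tr x = q.
  have [[y yq]|nq] := pselect (exists y, oball (- Z.of_nat j) y /\ tr y = q); first by exists y.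
  by exists 0.
pose F g : {ffun Q -> Q} := [ffun q => tr (act g (rep q))].
have /choice[h hP] (v : {ffun Q -> Q}) : exists g, (exists g', F g' = v) -> F g = v.
  have [[g gv]|nv] := pselect (exists g', F g' = v); first by exists g.
  by exists 0.
exists {ffun Q -> Q}, h => g; exists (F g) => x xj.
have Fg : F (h (F g)) = F g by apply: hP; exists g.
have [yj yx] : oball (- Z.of_nat j) (rep (tr x)) /\ tr (rep (tr x)) = tr x.
  by apply: repP; exists x.
set y := rep (tr x) in yj yx.
have xy0 : oball 0 (x - y) by apply: trP.
have y0 : oball 0 (act g y - act (h (F g)) y).
  apply: trP; try exact: oball_act.
  by have /ffunP/(_ (tr x)) := Fg; rewrite !ffunE.
(* Comparison through the representative [y]: each of the three terms lies in Z. *)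
have -> : act g x - act (h (F g)) x =
    act g (x - y) + (act g y - act (h (F g)) y) - act (h (F g)) (x - y).
  by rewrite !act_sub addrA subrK opprB addrA subrK.
by apply: oballB; [apply: oballD => //|]; apply: oball_act.
Qed.

(** * The operators [f] - 1, generators of the augmentation ideal of the group ring *)

Definition aug (f : LS p) (x : X p d) : X p d := act f x - x.

Lemma aug_add f x y : aug f (x + y) = aug f x + aug f y.
Proof. by rewrite /aug act_add opprD addrACA. Qed.
Lemma aug_sub f x y : aug f (x - y) = aug f x - aug f y.
Proof. by apply/eqP; rewrite eq_sym subr_eq -aug_add subrK. Qed.
Lemma aug_0 f : aug f 0 = 0.
Proof. by rewrite /aug act_0 subrr. Qed.
Lemma augC f g x : aug f (aug g x) = aug g (aug f x).
Proof.
rewrite /aug !act_sub actC !opprB -!addrA; congr (_ + _).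
by rewrite addrCA [RHS]addrCA [- _ - _]addrC.
Qed.
Lemma aug_shift k f x : aug f (shiftX k x) = shiftX k (aug (shift (- k) f) x).
Proof.
by rewrite /aug shiftXB -act_shift shift_shift Z.add_opp_diag_r shift0.
Qed.
Lemma oball_aug k f x : oball k x -> oball k (aug f x).
Proof. by move=> Hx; apply: oballB => //; apply: oball_act. Qed.

(** Binomial expansion of (1 + [aug f])^n. *)
Lemma iter_act n f x :
  iter n (act f) x = \sum_(i < n.+1) iter i (aug f) x *+ 'C(n, i).
Proof.
elim: n => [|n IHn]; first by rewrite big_ord_recl big_ord0 addr0 mulr1n.
have actE y : act f y = y + aug f y by rewrite addrC subrK.
have augS (I : finType) (F : I -> X p d) : aug f (\sum_i F i) = \sum_i aug f (F i).
  exact: (big_morph _ (aug_add f) (aug_0 f)).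
have augMn y m : aug f (y *+ m) = aug f y *+ m.
  by elim: m => [|m IHm]; rewrite ?mulr0n ?aug_0 // !mulrS aug_add IHm.
rewrite /= IHn actE augS [RHS]big_ord_recl /= bin0.
under [X in _ = _ + X]eq_bigr => i _ do
  rewrite /bump /= add1n binS mulrnDr.
rewrite [X in _ = _ + X]big_split /= addrA; congr (_ + _); last first.
  by apply: eq_bigr => i _; rewrite augMn.
rewrite [X in _ = _ + X]big_ord_recr /= bin_small // mulr0n addr0.
by rewrite big_ord_recl /= bin0.
Qed.

(** In characteristic p, ([f] - 1)^p = [f]^p - 1 = [p f] - 1 = 0. *)
Lemma iter_aug_p f x : iter p (aug f) x = 0.
Proof.
have LSp (g : LS p) : g *+ p = 0.
  apply: ls_eq => n; have -> m : coef (g *+ m) n = coef g n *+ m.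
    by elim: m => [|m IHm]; rewrite ?mulr0n // !mulrS -IHm.
  by rewrite -mulr_natr (pcharf0 (pchar_Fp p_prime)) mulr0.
have iterD n y : iter n (act f) y = act (f *+ n) y.
  by elim: n => [|n IHn]; rewrite ?mulr0n ?act0 // mulrS actD -IHn.
have Xp (y : X p d) : y *+ p = 0.
  apply/funext => i; have -> m : (y *+ m) i = y i *+ m.
    by elim: m => [|m IHm]; rewrite ?mulr0n // !mulrS -IHm.
  exact: LSp.
have := iterD p x; rewrite LSp act0 iter_act big_ord_recr /= binn mulr1n.
rewrite (bigD1 (Ordinal (prime_gt0 p_prime))) //= bin0 mulr1n big1 => [|i i0].
  by rewrite addr0 => /eqP; rewrite -subr_eq0 addrAC subrr add0r => /eqP.
have /dvdnP[q ->] : (p %| 'C(p, i))%N.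
  by apply: prime_dvd_bin => //; rewrite lt0n ltn_ord andbT.
by rewrite mulrnA Xp.
Qed.

Definition augs (w : seq (LS p)) (x : X p d) : X p d := foldr aug x w.

Lemma augs_cat u v x : augs (u ++ v) x = augs u (augs v x).
Proof. exact: foldr_cat. Qed.
Lemma augs_0 w : augs w 0 = 0.
Proof. by elim: w => //= g w ->; rewrite aug_0. Qed.
Lemma augs_aug w g x : augs w (aug g x) = aug g (augs w x).
Proof. by elim: w => //= h w ->; rewrite augC. Qed.
Lemma oball_augs k w x : oball k x -> oball k (augs w x).
Proof. by move=> Hx; elim: w => //= g w; apply: oball_aug. Qed.
(** Pigeonhole on commuting operators: a letter occurring [p] times kills the word. Otherwise
    deleting it costs fewer than [p] letters, so each letter of the alphabet adds [p] to the
    bound. *)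
Lemma augs_nilpotent (T : finType) (h : T -> LS p) :
  exists N, forall w x, (N <= size w)%N -> augs [seq h a | a <- w] x = 0.
Proof.
suff [N HN] : exists N, forall w x, {subset w <= enum T} -> (N <= size w)%N ->
    augs [seq h a | a <- w] x = 0.
  by exists N => w x Nw; apply: HN => // a _; rewrite mem_enum.
elim: (enum T) => [|a s [N IHs]].
  (* Over the empty alphabet there is no word of length at least 1. *)
  by exists 1%N => -[|b w] // x /(_ b (mem_head _ _)).
have split_a w x : augs (map h w) x =
    augs [seq h b | b <- w & predC1 a b] (iter (count_mem a w) (aug (h a)) x).
  elim: w => //= b w ->; rewrite -augs_aug; have [->|ba] //= := eqVneq b a.
  by rewrite augs_aug.
exists (N + p)%N => w x ws Nw; rewrite split_a.
have [pa|pa] := leqP p (count_mem a w).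
  rewrite -(subnK pa) iterD iter_aug_p.
  have -> : iter (count_mem a w - p) (aug (h a)) 0 = 0.
    by elim: (_ - _)%N => //= n ->; rewrite aug_0.
  exact: augs_0.
apply: IHs => [b|].
  by rewrite mem_filter => /andP[/= ba /ws]; rewrite inE (negPf ba).
rewrite size_filter (eq_count (a2 := predC (pred1 a))) //.
by have := count_predC (pred1 a) w; lia.
Qed.

(** Modulo Z, each letter can be replaced by one from the finite alphabet of [finite_action j], over
    which long words vanish. So tau^-j Z / Z lies in some term of the socle series. *)
Lemma augs_oball0 j : exists N, forall w x, (N <= size w)%N ->
  oball (- Z.of_nat j) x -> oball 0 (augs w x).
Proof.
have [T [h hP]] := finite_action j; have [N HN] := augs_nilpotent h.
exists N => w x Nw xj.
suff [v vw wv] : exists2 v, size v = size w & oball 0 (augs w x - augs (map h v) x).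
  by move: wv; rewrite HN ?subr0 // vw.
elim: w {Nw} => [|g w [v vw wv]].
  by exists [::] => //; rewrite subrr; apply: oball0.
have [a ga] := hP g; exists (a :: v); first by rewrite /= vw.
have -> : augs (g :: w) x - augs (map h (a :: v)) x =
    (act g (augs w x) - act (h a) (augs w x)) +
    aug (h a) (augs w x - augs (map h v) x).
  by rewrite aug_sub addrA {2}/aug addrA subrK /aug.
by apply: oballD; [apply: ga; apply: oball_augs|apply: oball_aug].
Qed.

(** * The socle series of W / Z when no vector of Z outside tau Z is almost fixed *)

Section NoAlmostFixed.
Variable k : nat.
Hypothesis no_fix : forall y,
  oball 0 y -> (forall f, ball (Z.of_nat k) (aug f y)) -> oball 1 y.

(** The preimage in W of the [i]-th socle of W / Z, that is, of the vectors killed by the [i]-th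
    power of the augmentation ideal. *)
Definition socle i x := (exists j, oball (- Z.of_nat j) x) /\
  forall w, size w = i -> oball 0 (augs w x).

(** If [x] lies in tau^-n Z with n > k, then t^n x lies in Z and is fixed modulo X_n, hence modulo
    X_k. So [no_fix] puts it in tau Z, which lowers n by one. *)
Lemma socle1_sub x : socle 1 x -> oball (- Z.of_nat k) x.
Proof.
move=> [[j xj] x1].
have {xj} : oball (- Z.of_nat (k + j)) x by apply: oball_le xj; lia.
elim: j => [|j IHj] xj; first by rewrite addn0 in xj.
apply: IHj.
have : oball 1 (shiftX (Z.of_nat (k + j.+1)) x).
  apply: no_fix => [|f]; first by apply/oball_shift.
  rewrite aug_shift; apply/ball_shift; apply: (@ball_le _ _ _ 0); first by lia.
  exact/oball_ball/(x1 [:: _]).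
by move/oball_shift; apply: oball_le; lia.
Qed.

Lemma socle_aug i g x : socle i.+1 x -> socle i (aug g x).
Proof.
move=> [[j xj] xi]; split; first by exists j; apply: oball_aug.
by move=> w wi; have := xi (rcons w g); rewrite size_rcons wi -cats1 augs_cat; apply.
Qed.

(** Each [f] - 1 maps [x] into the previous socle, so multiplication by t^(ik) brings [x] into the
    first one, where [socle1_sub] costs another [k]. *)
Lemma socle_sub i x : socle i x -> oball (- Z.of_nat (i * k)) x.
Proof.
elim: i x => [|i IHi] x sx; first by case: sx => _ /(_ [::] erefl).
have : socle 1 (shiftX (Z.of_nat (i * k)) x).
  case: (sx) => [[j xj] _]; split.
    by exists j; apply/oball_shift; apply: oball_le xj; lia.
  case=> [|f [|//]] // _.
  by rewrite [augs _ _]aug_shift; apply/oball_shift; rewrite Z.sub_0_l; apply/IHi/socle_aug.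
by move/socle1_sub/oball_shift; apply: oball_le; lia.
Qed.

(* [i - 1] of the [i] factors map [x] into the second socle, on which [G] acts
   through a finite quotient; as the factors commute, each may be replaced by
   a letter of a fixed finite alphabet, and long words over it vanish. *)
Lemma socle_stable : exists N, forall i x, (N <= i)%N -> socle i.+1 x -> socle i x.
Proof.
have [T [h hP]] := finite_action (2 * k); have [N HN] := augs_nilpotent h.
exists N => i x Ni sx; case: (sx) => xj xi; split=> // w wi.
suff H u (v : seq T) : (size u + size v)%N = i -> oball 0 (augs (u ++ map h v) x).
  by have := H w [::]; rewrite cats0 addn0; apply.
elim: u v => [|g u IHu] v /= uv.
  by rewrite HN; [apply: oball0|lia].
have [a ga] := hP g; set y := augs _ _.
have sy : socle 2 y.
  split; first by case: xj => j xj; exists j; apply: oball_augs.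
  move=> w2 w2s; rewrite /y -augs_cat; apply: xi.
  by rewrite !size_cat size_map w2s; lia.
have -> : aug g y = (act g y - act (h a) y) + aug (h a) y by rewrite addrA subrK.
apply: oballD; first exact/ga/socle_sub.
rewrite /y augs_cat -augs_aug; have := IHu (a :: v); rewrite augs_cat; apply.
by rewrite /= addnS.
Qed.

(** The series stops at [N], so all of W lies in tau^-(Nk) Z. Applied to t^-s x with s = Nk + l,
    this puts [x] in tau^l Z for every l >= 0. *)
Lemma oball_trivial x : oball 0 x -> x = 0.
Proof.
have [N HN] := socle_stable.
have sN i y : socle (i + N)%N y -> socle N y.
  by elim: i => // i IHi; rewrite addSn => /HN-/(_ (leq_addl _ _)).
have sub j y : oball (- Z.of_nat j) y -> oball (- Z.of_nat (N * k)) y.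
  move=> yj; have [M HM] := augs_oball0 j.
  apply/socle_sub/(sN M); split; first by exists j.
  by move=> w wM; apply: HM => //; rewrite wM leq_addr.
move=> x0; apply: ball_all_eq0 => l.
pose s := (Z.of_nat (N * k) + Z.of_nat (Z.to_nat l))%Z.
have : oball (- Z.of_nat (N * k + Z.to_nat l)) (shiftX (- s) x).
  by apply/oball_shift; apply: oball_le x0; lia.
by move=> /sub /oball_shift /oball_ball; apply: ball_le; lia.
Qed.
End NoAlmostFixed.

(** * A fixed vector as a limit of almost fixed ones *)

Lemma exists_fixed : exists x, x <> 0 /\ forall f, act f x = x.
Proof.
have [n oball1] := oball_open.
have [y [y1 y0]] := bounded_orbit.
pose S k x := [/\ oball 0 x, ~ oball 1 x & forall f, ball (Z.of_nat k) (aug f x)].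
have [||||x Sx] := @nested_inter p d S.
- by move=> k x [/oball_ball].
- move=> k x /not_and3P[/existsNP[f fx]|/contrapT x1|/existsNP[f fx]].
  + have [N HN] := act_ball_closed fx; exists N => z zx [z0 _ _].
    exact: HN zx (z0 f).
  (* By [oball_open], tau Z is open in Z, so excluding it is a closed condition. This keeps the
     limit nonzero. *)
  + exists n => z zx [z0 nz1 _]; apply: nz1; rewrite -(subrK x z).
    apply: oballD => //; apply: oball1 => //; apply: oballB => //.
    by apply: oball_le x1.
  + have [N HN] := act_ball f (Z.of_nat k).
    exists (Z.max N (Z.of_nat k)) => z zx [_ _ /(_ f) zf]; apply: fx.
    rewrite -(subKr (z : X p d) x) aug_sub; apply: ballB => //; apply: ballB.
      by apply: HN; apply: ball_le zx; lia.
    by apply: ball_le zx; lia.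
- by move=> k x [x0 x1 xf]; split=> // f; apply: ball_le (xf f); lia.
- move=> k; apply: contrapT => nS; apply: y1.
  have -> // : y = 0.
  apply: (@oball_trivial k) => // z z0 zf.
  by apply: contrapT => z1; apply: nS; exists z.
exists x; split.
  by move=> x0; case: (Sx 0%N) => _ []; rewrite x0; apply: oball0.
move=> f; apply/eqP; rewrite -subr_eq0; apply/eqP; apply: ball_all_eq0 => k.
by case: (Sx (Z.to_nat k)) => _ _ /(_ f); apply: ball_le; lia.
Qed.

End Action.

Theorem theoremB (p d : nat) (hp : prime p) (hd : (0 < d)%N)
  (phi : LS p -> Aut p d)
  (hhom : forall (f g : LS p) (x : X p d),
      aut_fun (phi (ls_add f g)) x = aut_fun (phi f) (aut_fun (phi g) x))
  (hcont : forall W : Aut p d -> Prop, openAut W -> openLS (fun f => W (phi f)))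
  (hconj : forall (f : LS p) (x : X p d),
      aut_fun (phi (ls_t f)) x = tau (aut_fun (phi f) (tau_inv x))) :
  exists xi : X p d, xi <> @X0 p d /\ forall f : LS p, aut_fun (phi f) xi = xi.
Proof. exact: (exists_fixed hp hd hhom hcont hconj). Qed.
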